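(* Let $n\ge1$, let $\{X^u\}_{u\in\mathbb{N}^n}$ be a one-critical, exhaustive $n$-parameter filtration of a cell complex $X$, and let $q\in\mathbb{N}$. Let $F_1\xrightarrow{\phi_1}F_0\xrightarrow{\varepsilon}\ker\partial_q\to0$ be a minimal free presentation of the $n$-graded $S$-module $\ker\partial_q$, where $\partial_q:C_q\to C_{q-1}$, let $\overline{\partial}:C_{q+1}\to F_0$ be an $n$-graded homomorphism with $\varepsilon\overline{\partial}=\partial_{q+1}$, and let $h:\ker\partial_q\to V_q=\ker\partial_q/\operatorname{im}\partial_{q+1}$ be the projection. Consider the free presentation $$C_{q+1}\oplus F_1\xrightarrow{[\overline{\partial}\;\phi_1]}F_0\xrightarrow{h\varepsilon}V_q\to0$$ of $V_q$, where $[\overline{\partial}\;\phi_1](c,x)=\overline{\partial}(c)+\phi_1(x)$. Then the modules in this presentation satisfy $$\operatorname{supp}\xi_0(F_0)\subseteq\overline{\mathcal{G}(X_q)}\qquad\text{and}\qquad\operatorname{supp}\xi_0(C_{q+1}\oplus F_1)\subseteq\mathcal{G}(X_{q+1})\cup\overline{\mathcal{G}(X_q)}.$$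
   Context: $\mathbb{F}$ is a fixed field, $\mathbb{N}=\{0,1,\dots\}$, $e_1,\dots,e_n$ is the standard basis of $\mathbb{N}^n$, $\preceq$ is the coordinatewise order on $\mathbb{N}^n$, with least upper bound $\bigvee$, and $S=\mathbb{F}[x_1,\dots,x_n]$ with its $\mathbb{N}^n$-grading. All $n$-graded $S$-modules $V=\bigoplus_{u\in\mathbb{N}^n}V^u$ are finitely generated and homomorphisms preserve grades. $S(-a)$ is the free module on one generator in grade $a\in\mathbb{N}^n$; a free $n$-graded module is a finite direct sum of such. A free presentation of $V$ is a homomorphism $\phi_1:F_1\to F_0$ of free $n$-graded modules with cokernel $V$; it is minimal if it is the part in degrees $1,0$ of a minimal free resolution (a free resolution $F_*$ in which the image of each $\phi_i$ lies in $\langle x_1,\dots,x_n\rangle F_{i-1}$). $\xi_0(V)(u)=\dim_{\mathbb{F}}(V\otimes_S\mathbb{F})^u$, where $\mathbb{F}=S/\langle x_1,\dots,x_n\rangle$, and $\operatorname{supp}\xi_0(V)=\{u\mid\xi_0(V)(u)\ne0\}$ (for a free module this is the set of grades of its generators). A cell complex is a finite graded set $X=\bigsqcup_{q\in\mathbb{N}}X_q$ (elements of $X_q$ are $q$-cells) with an incidence function $\kappa:X\times X\to\mathbb{F}$ such that $\kappa(\tau,\sigma)\neq0$ implies $\dim\tau=\dim\sigma+1$, and $\sum_{\rho\in X}\kappa(\tau,\rho)\kappa(\rho,\sigma)=0$ for all $\tau,\sigma$. The face partial order $\le$ on $X$ is generated by $\sigma<\tau$ whenever $\kappa(\tau,\sigma)\ne0$.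 $C_*(X)$ is the chain complex with $C_q(X)$ the $\mathbb{F}$-vector space with basis $X_q$ and $\partial_q(\tau)=\sum_{\sigma\in X_{q-1}}\kappa(\tau,\sigma)\sigma$ (with $C_q=0$ for $q<0$). A subcomplex is a subset closed under passing to faces, with the restricted incidence function. An $n$-parameter filtration of $X$ is a family of subcomplexes $\{X^u\}_{u\in\mathbb{N}^n}$ with $X^u\subseteq X^v$ for $u\preceq v$; one sets $X^w=\emptyset$ if $w\notin\mathbb{N}^n$. It is exhaustive if $X=\bigcup_uX^u$. A grade $u$ is an entrance grade of a cell $\sigma$ if $\sigma\in X^u\setminus\bigcup_{j=1}^nX^{u-e_j}$. The filtration is one-critical if $X^u=\{\sigma\in X\mid h'(\sigma)\preceq u\}$ for some order-preserving $h':(X,\le)\to(\mathbb{N}^n,\preceq)$ (equivalently, every cell has exactly one entrance grade). $C_q=\bigoplus_{u\in\mathbb{N}^n}C_q(X^u)$ is the associated $n$-graded $S$-module ($x_i$ acting by the inclusions $C_q(X^u)\hookrightarrow C_q(X^{u+e_i})$), which is free by one-criticality, $\partial_q:C_q\to C_{q-1}$ is the induced $n$-graded homomorphism, and $V_q=\bigoplus_uH_q(X^u)$. $\mathcal{G}(X_q)\subseteq\mathbb{N}^n$ is the set of entrance grades of the $q$-cells, and for $G\subseteq\mathbb{N}^n$, $\overline{G}=\{\bigvee L\mid L\subseteq G\text{ finite}, L\ne\emptyset\}$. *)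

(* Defs.v *)
From Stdlib Require Import ClassicalEpsilon.
From HB Require Import structures.
From mathcomp Require Import all_boot all_order all_algebra.
From mathcomp Require Import freeg mpoly.

Set Implicit Arguments.
Unset Strict Implicit.
Unset Printing Implicit Defensive.

Import GRing.Theory.

Local Open Scope ring_scope.
Local Open Scope quotient_scope.

(* Submodules are Prop-valued; excluded middle turns them into the boolean    *)
(* predicates that mathcomp's subtypes and quotients require.                 *)
Record submodule (R : comNzRingType) (M : lmodType R) := Submodule {
  smem :> M -> Prop;
  smem0 : smem 0;
  smemL : forall (a : R) (u v : M), smem u -> smem v -> smem (a *: u + v)
}.

Section SubQuotient.
Context (R : comNzRingType) (M : lmodType R) (N : submodule M).

Definition smemb : {pred M} :=
  fun v => if excluded_middle_informative (N v) then true else false.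

Lemma smembP v : reflect (N v) (v \in smemb).
Proof.
by rewrite /in_mem /= /smemb; case: excluded_middle_informative; constructor.
Qed.

Lemma smemb_closed : submod_closed smemb.
Proof.
split=> [|a u v /smembP Nu /smembP Nv]; apply/smembP; first exact: smem0.
exact: smemL.
Qed.

HB.instance Definition _ := GRing.isSubmodClosed.Build R M smemb smemb_closed.

Record submod := Submod { submod_val : M; _ : submod_val \in smemb }.

HB.instance Definition _ := [isSub for submod_val].
HB.instance Definition _ := [Choice of submod by <:].
HB.instance Definition _ := [SubChoice_isSubLmodule of submod by <:].

Lemma submodP (v : submod) : N (val v).
Proof. exact/smembP/valP. Qed.

Definition mk_submod (v : M) (Nv : N v) : submod := Submod (introT (smembP v) Nv).

Definition quotmod : Type := Quotient.quot smemb.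

HB.instance Definition _ := GRing.Zmodule.on quotmod.

Definition quot_pi : M -> quotmod := \pi_(Quotient.quot smemb).

Definition quot_scale (a : R) (x : quotmod) : quotmod := quot_pi (a *: repr x).

Lemma quot_pi_surj x : exists v, quot_pi v = x.
Proof. by exists (repr x); rewrite /quot_pi reprK. Qed.

Lemma quot_pi_eq u v : quot_pi u = quot_pi v <-> N (u - v).
Proof.
split=> [/eqP|/smembP]; last first.
  by rewrite Quotient.idealrBE => /eqP.
by rewrite /quot_pi -Quotient.idealrBE => /smembP.
Qed.

Lemma quot_piB : zmod_morphism quot_pi.
Proof. exact: raddfB. Qed.

HB.instance Definition _ :=
  GRing.isZmodMorphism.Build M quotmod quot_pi quot_piB.

Lemma quot_piZ a v : quot_pi (a *: v) = quot_scale a (quot_pi v).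
Proof.
apply/quot_pi_eq; rewrite -scalerBr; apply/smembP/rpredZ/smembP/quot_pi_eq.
by rewrite /quot_pi reprK.
Qed.

Lemma quot_scaleA a b x : quot_scale a (quot_scale b x) = quot_scale (a * b) x.
Proof. by have [v <-] := quot_pi_surj x; rewrite -!quot_piZ scalerA. Qed.

Lemma quot_scale1 : left_id 1 quot_scale.
Proof. by move=> x; have [v <-] := quot_pi_surj x; rewrite -quot_piZ scale1r. Qed.

Lemma quot_scaleDr : right_distributive quot_scale +%R.
Proof.
move=> a x y; have [v <-] := quot_pi_surj x; have [w <-] := quot_pi_surj y.
by rewrite -raddfD -!quot_piZ -raddfD scalerDr.
Qed.

Lemma quot_scaleDl x : {morph quot_scale^~ x : a b / a + b}.
Proof.
by move=> a b; have [v <-] := quot_pi_surj x; rewrite -!quot_piZ -raddfD scalerDl.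
Qed.

HB.instance Definition _ := GRing.Zmodule_isLmodule.Build R quotmod
  quot_scaleA quot_scale1 quot_scaleDr quot_scaleDl.

Lemma quot_pi_scalable : scalable quot_pi.
Proof. by move=> a v; rewrite quot_piZ. Qed.

HB.instance Definition _ := GRing.isScalable.Build R M quotmod *:%R quot_pi
  quot_pi_scalable.

End SubQuotient.

Section Span.
Context (R : comNzRingType) (M : lmodType R).

Definition in_gen (G : M -> Prop) (v : M) : Prop :=
  exists2 s : seq (R * M), (forall p, p \in s -> G p.2) &
    v = \sum_(p <- s) p.1 *: p.2.

Lemma in_gen0 G : in_gen G 0.
Proof. by exists [::] => //; rewrite big_nil. Qed.

Lemma in_genL G a u v : in_gen G u -> in_gen G v -> in_gen G (a *: u + v).
Proof.
move=> [s Gs ->] [t Gt ->]; exists ([seq (a * p.1, p.2) | p <- s] ++ t).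
  by move=> p; rewrite mem_cat => /orP[/mapP[p' /Gs ? ->]|/Gt].
rewrite big_cat big_map scaler_sumr; congr (_ + _).
by apply: eq_bigr => p _; rewrite scalerA.
Qed.

Definition gen_submod (G : M -> Prop) : submodule M :=
  Submodule (in_gen0 G) (@in_genL G).

Lemma gen_submod_in (G : M -> Prop) v : G v -> gen_submod G v.
Proof.
by move=> Gv; exists [:: (1, v)] => [p|]; rewrite ?big_seq1 ?scale1r // inE => /eqP->.
Qed.

End Span.

(* M (x)_R M': the free R-module on pairs modulo the bilinearity relations.   *)
Section Tensor.
Context (R : comNzRingType) (M M' : lmodType R).

Inductive tensor_rel : {freeg (M * M')%type / R} -> Prop :=
| tensor_rel_l a u v w :
    tensor_rel (<< (a *: u + v, w) >> - (a *: << (u, w) >> + << (v, w) >>))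
| tensor_rel_r a u v w :
    tensor_rel (<< (w, a *: u + v) >> - (a *: << (w, u) >> + << (w, v) >>)).

Definition tensor : lmodType R := quotmod (gen_submod tensor_rel).

Definition tens (v : M) (w : M') : tensor := quot_pi (gen_submod tensor_rel) << (v, w) >>.

End Tensor.

(* Grades are vectors of N^n, written as monomials 'X_{1..n}: (_ <= _)%MM is  *)
(* the coordinatewise order, mlcm the join, and U_(i)%MM is e_i.              *)
Section Graded.
Context (F : fieldType) (n : nat).
Local Notation S := {mpoly F[n]}.
Local Notation grade := 'X_{1..n}.

(* The last two fields say that M is the direct sum of its graded parts.      *)
(* Finite generation is not required here; a module with a free presentation  *)
(* is finitely generated since is_free includes finite rank.                  *)
Record gmod := Gmod {
  gcar :> lmodType S;
  gr : grade -> gcar -> Prop;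
  gr0 : forall u, gr u 0;
  grL : forall u (c : F) v w, gr u v -> gr u w -> gr u (c%:MP *: v + w);
  grX : forall u i v, gr u v -> gr (u + U_(i))%MM ('X_i *: v);
  gr_decomp : forall v, exists (s : seq grade) (f : grade -> gcar),
    [/\ uniq s, forall u, gr u (f u) & v = \sum_(u <- s) f u];
  gr_indep : forall (s : seq grade) (f : grade -> gcar),
    uniq s -> (forall u, gr u (f u)) -> \sum_(u <- s) f u = 0 ->
    forall u, u \in s -> f u = 0
}.

Record ghom (M N : gmod) := Ghom {
  ghom_fun :> {linear M -> N};
  ghom_gr : forall u v, gr u v -> gr u (ghom_fun v)
}.

Section GhomComp.
Context (M N P : gmod) (g : ghom N P) (f : ghom M N).
Lemma gcomp_gr u v : gr u v -> gr u ((g \o f) v).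
Proof. by move=> /(ghom_gr f) /(ghom_gr g). Qed.
Definition gcomp : ghom M P := @Ghom M P (g \o f)%FUN gcomp_gr.
End GhomComp.

Definition giso (M N : gmod) : Prop :=
  exists (f : ghom M N) (g : ghom N M), cancel f g /\ cancel g f.

Lemma grD (M : gmod) u (v w : M) : gr u v -> gr u w -> gr u (v + w).
Proof. by move=> gv gw; rewrite -[v]scale1r -mpolyC1; apply: grL. Qed.

Section DirectSum.
Context (M N : gmod).

Definition dsum_gr u (x : (M * N)%type) : Prop := gr u x.1 /\ gr u x.2.

Lemma dsum_gr0 u : dsum_gr u 0.
Proof. by split; apply: gr0. Qed.

Lemma dsum_grL u (c : F) v w :
  dsum_gr u v -> dsum_gr u w -> dsum_gr u (c%:MP *: v + w).
Proof. by move=> [? ?] [? ?]; split; apply: grL. Qed.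

Lemma dsum_grX u i v : dsum_gr u v -> dsum_gr (u + U_(i))%MM ('X_i *: v).
Proof. by move=> [? ?]; split; apply: grX. Qed.

Lemma fst_sum (s : seq grade) (f : grade -> (M * N)%type) :
  (\sum_(u <- s) f u).1 = \sum_(u <- s) (f u).1.
Proof. by elim/big_rec2: _ => //= u x y _ <-. Qed.

Lemma snd_sum (s : seq grade) (f : grade -> (M * N)%type) :
  (\sum_(u <- s) f u).2 = \sum_(u <- s) (f u).2.
Proof. by elim/big_rec2: _ => //= u x y _ <-. Qed.

Lemma sum_widen (V : zmodType) (s t : seq grade) (f : grade -> V) :
  uniq s -> uniq t -> {subset s <= t} ->
  \sum_(u <- s) f u = \sum_(u <- t) (if u \in s then f u else 0).
Proof.
move=> us ut sub; rewrite -big_mkcond -[RHS]big_filter; apply: perm_big.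
apply: uniq_perm => //; first exact: filter_uniq.
by move=> u; rewrite mem_filter; case us': (u \in s) => //=; rewrite sub.
Qed.

Lemma dsum_decomp v : exists (s : seq grade) (f : grade -> (M * N)%type),
  [/\ uniq s, forall u, dsum_gr u (f u) & v = \sum_(u <- s) f u].
Proof.
have [s [f [us gf ef]]] := gr_decomp v.1.
have [t [g [ut gg eg]]] := gr_decomp v.2.
exists (undup (s ++ t)), (fun u => (if u \in s then f u else 0,
                                    if u \in t then g u else 0)).
split=> [|u|]; first exact: undup_uniq.
  by split=> /=; case: ifP => _ //; apply: gr0.
apply: injective_projections; rewrite ?fst_sum ?snd_sum /=.
  by rewrite ef; apply: sum_widen; rewrite ?undup_uniq // => u us';
    rewrite mem_undup mem_cat us'.
by rewrite eg; apply: sum_widen; rewrite ?undup_uniq // => u us';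
  rewrite mem_undup mem_cat us' orbT.
Qed.

Lemma dsum_indep (s : seq grade) (f : grade -> (M * N)%type) :
  uniq s -> (forall u, dsum_gr u (f u)) -> \sum_(u <- s) f u = 0 ->
  forall u, u \in s -> f u = 0.
Proof.
move=> us gf e u ins; apply: injective_projections => /=.
  apply: (gr_indep (f := fun u => (f u).1) us) => // [w|]; first by case: (gf w).
  by rewrite -fst_sum e.
apply: (gr_indep (f := fun u => (f u).2) us) => // [w|]; first by case: (gf w).
by rewrite -snd_sum e.
Qed.

Definition dsum : gmod :=
  @Gmod (M * N)%type dsum_gr dsum_gr0 dsum_grL dsum_grX dsum_decomp dsum_indep.

End DirectSum.

Section Copair.
Context (M N P : gmod) (f : ghom M P) (g : ghom N P).

Definition copair_fun (x : dsum M N) : P := f x.1 + g x.2.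

Lemma copair_linear : linear copair_fun.
Proof. by move=> a x y; rewrite /copair_fun !linearP scalerDr addrACA. Qed.

HB.instance Definition _ :=
  GRing.isLinear.Build S (dsum M N) P *:%R copair_fun copair_linear.

Lemma copair_gr u v : gr u v -> gr u (copair_fun v).
Proof. by move=> [? ?]; apply: grD; apply: ghom_gr. Qed.

Definition copair : ghom (dsum M N) P := @Ghom (dsum M N) P copair_fun copair_gr.

End Copair.

(* The direct sum of the S(-a i), i : I, with S(-a)^u = S^(u - a).            *)
Section Free.
Context (I : finType) (a : I -> grade).
Local Notation car := {ffun I -> S^o}.

Definition free_gr (u : grade) (v : car) : Prop :=
  forall i m, m \in msupp (v i : S) -> (m + a i)%MM = u.

Lemma free_gr0 u : free_gr u 0.
Proof. by move=> i m; rewrite ffunE msupp0. Qed.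

Lemma free_grL u (c : F) v w :
  free_gr u v -> free_gr u w -> free_gr u (c%:MP *: v + w).
Proof.
move=> gv gw i m; rewrite !ffunE => /msuppD_le; rewrite mem_cat => /orP[|/gw //].
rewrite /GRing.scale /= mcoeff_msupp mcoeffCM mulf_eq0 negb_or => /andP[_].
by rewrite -mcoeff_msupp => /gv.
Qed.

Lemma free_grX u i v : free_gr u v -> free_gr (u + U_(i))%MM ('X_i *: v).
Proof.
move=> gv j m; rewrite ffunE /GRing.scale /= mulrC (perm_mem (msuppMX _ _)).
by case/mapP => k /gv <- ->; rewrite -addmA addmC.
Qed.

Definition free_comp (v : car) (u : grade) : car :=
  [ffun i => \sum_(m <- msupp (v i : S) | (m + a i)%MM == u)
               (v i : S)@_m *: 'X_[m]].

Lemma free_comp_coeff v u i m :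
  ((free_comp v u i : S)@_m = if (m + a i)%MM == u then (v i : S)@_m else 0).
Proof.
rewrite ffunE; rewrite [X in mcoeff m X = _](_ : _ = \sum_(k <- msupp (v i : S))
  (if (k + a i)%MM == u then (v i : S)@_k else 0) *: 'X_[k]); last first.
  rewrite big_mkcond; apply: eq_bigr => k _; by case: ifP; rewrite ?scale0r.
rewrite raddf_sum /=.
rewrite (eq_bigr (fun k => if k == m then
    (if (m + a i)%MM == u then (v i : S)@_m else 0) else 0)); last first.
  move=> k _; rewrite mcoeffZ mcoeffX; have [->|_] := eqVneq k m; first by rewrite mulr1.
  by rewrite mulr0.
have [ms|nms] := boolP (m \in msupp (v i : S)).
  rewrite (bigD1_seq m) ?msupp_uniq //= eqxx big1 ?addr0 // => k /negPf->//.
rewrite big1_seq => [|k /= ks]; last first.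
  by have [e|//] := eqVneq k m; rewrite -e ks in nms.
by rewrite (memN_msupp_eq0 nms); case: ifP.
Qed.

Lemma free_decomp v : exists (s : seq grade) (f : grade -> car),
  [/\ uniq s, forall u, free_gr u (f u) & v = \sum_(u <- s) f u].
Proof.
exists (undup (flatten [seq [seq (m + a i)%MM | m <- msupp (v i : S)] | i <- enum I])).
exists (free_comp v); split=> [|u i m|]; first exact: undup_uniq.
  by rewrite mcoeff_msupp free_comp_coeff; case: ifP => [/eqP //|_]; rewrite eqxx.
apply/ffunP => i; rewrite sum_ffunE; apply/mpolyP => m; rewrite raddf_sum /=.
under eq_bigr do rewrite free_comp_coeff.
have [ms|nms] := boolP (m \in msupp (v i : S)).
  rewrite (bigD1_seq (m + a i)%MM) ?undup_uniq //= ?eqxx ?big1 ?addr0 //.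
    by move=> k; rewrite eq_sym => /negPf->.
  rewrite mem_undup; apply/flatten_mapP; exists i; rewrite ?mem_enum //.
  exact: map_f.
by rewrite big1 (memN_msupp_eq0 nms) // => u _; case: ifP.
Qed.

Lemma free_indep (s : seq grade) (f : grade -> car) :
  uniq s -> (forall u, free_gr u (f u)) -> \sum_(u <- s) f u = 0 ->
  forall u, u \in s -> f u = 0.
Proof.
move=> us gf e u ins; apply/ffunP => i; rewrite ffunE; apply/mpolyP => m.
rewrite mcoeff0; have [ms|/memN_msupp_eq0 //] := boolP (m \in msupp (f u i : S)).
have eu := gf _ _ _ ms.
have /(congr1 (fun g : car => (g i : S)@_m)) := e.
rewrite sum_ffunE raddf_sum /= ffunE mcoeff0 (bigD1_seq u) //= big1 ?addr0 //.
move=> w wu; apply: memN_msupp_eq0; apply/negP => /gf.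
by rewrite eu => /esym/eqP; apply/negP.
Qed.

Definition free_gmod : gmod :=
  @Gmod car free_gr free_gr0 free_grL free_grX free_decomp free_indep.

End Free.

Definition is_free (M : gmod) : Prop :=
  exists (r : nat) (a : 'I_r -> grade), giso M (free_gmod a).

Definition homogeneous (M : gmod) (N : submodule M) : Prop :=
  forall (s : seq grade) (f : grade -> M), uniq s -> (forall u, gr u (f u)) ->
    N (\sum_(u <- s) f u) -> forall u, u \in s -> N (f u).

Section SubQuotGmod.
Context (M : gmod) (N : submodule M) (homN : homogeneous N).

Definition sub_gr u (x : submod N) : Prop := gr u (val x).

Lemma sub_gr0 u : sub_gr u 0.
Proof. by rewrite /sub_gr raddf0; apply: gr0. Qed.

Lemma sub_grL u (c : F) v w :
  sub_gr u v -> sub_gr u w -> sub_gr u (c%:MP *: v + w).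
Proof. by rewrite /sub_gr linearP; apply: grL. Qed.

Lemma sub_grX u i v : sub_gr u v -> sub_gr (u + U_(i))%MM ('X_i *: v).
Proof. by rewrite /sub_gr linearZ; apply: grX. Qed.

Lemma sub_decomp v : exists (s : seq grade) (f : grade -> submod N),
  [/\ uniq s, forall u, sub_gr u (f u) & v = \sum_(u <- s) f u].
Proof.
have [s [f [us gf ef]]] := gr_decomp (val v).
have Nf u : u \in s -> N (f u) by apply: homN; rewrite // -ef; apply: submodP.
pose g u : submod N := insubd (0 : submod N) (f u).
exists s, g; split=> // [u|].
  rewrite /sub_gr val_insubd; case: ifP => _; first exact: gf.
  by rewrite raddf0; apply: gr0.
apply: val_inj; rewrite ef raddf_sum; apply: eq_big_seq => u ins /=.
by rewrite val_insubd; case: smembP => // -[]; apply: Nf.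
Qed.

Lemma sub_indep (s : seq grade) (f : grade -> submod N) :
  uniq s -> (forall u, sub_gr u (f u)) -> \sum_(u <- s) f u = 0 ->
  forall u, u \in s -> f u = 0.
Proof.
move=> us gf e u ins; apply: val_inj; rewrite raddf0.
apply: (gr_indep (f := fun u => val (f u)) us) => //.
by rewrite -raddf_sum e raddf0.
Qed.

Definition sub_gmod : gmod :=
  @Gmod (submod N) sub_gr sub_gr0 sub_grL sub_grX sub_decomp sub_indep.

Definition quot_gr u (x : quotmod N) : Prop := exists2 v, gr u v & quot_pi N v = x.

Lemma quot_gr0 u : quot_gr u 0.
Proof. by exists 0; [apply: gr0 | apply: raddf0]. Qed.

Lemma quot_grL u (c : F) v w :
  quot_gr u v -> quot_gr u w -> quot_gr u (c%:MP *: v + w).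
Proof.
move=> [x gx <-] [y gy <-]; exists (c%:MP *: x + y); first exact: grL.
by rewrite linearP.
Qed.

Lemma quot_grX u i v : quot_gr u v -> quot_gr (u + U_(i))%MM ('X_i *: v).
Proof.
by move=> [x gx <-]; exists ('X_i *: x); [apply: grX | rewrite linearZ].
Qed.

Lemma quot_decomp v : exists (s : seq grade) (f : grade -> quotmod N),
  [/\ uniq s, forall u, quot_gr u (f u) & v = \sum_(u <- s) f u].
Proof.
have [x <-] := quot_pi_surj v; have [s [f [us gf ->]]] := gr_decomp x.
exists s, (fun u => quot_pi N (f u)); split=> // [u|]; first by exists (f u).
by rewrite raddf_sum.
Qed.

Lemma quot_indep (s : seq grade) (f : grade -> quotmod N) :
  uniq s -> (forall u, quot_gr u (f u)) -> \sum_(u <- s) f u = 0 ->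
  forall u, u \in s -> f u = 0.
Proof.
move=> us gf e u ins.
have gfP w : exists v, gr w v /\ quot_pi N v = f w by have [v] := gf w; exists v.
pose g w := proj1_sig (constructive_indefinite_description _ (gfP w)).
have gg w : gr w (g w) /\ quot_pi N (g w) = f w.
  by rewrite /g; case: constructive_indefinite_description.
rewrite -(gg u).2 -(raddf0 (quot_pi N)); apply/quot_pi_eq; rewrite subr0.
apply: (homN us) => // [w|]; first exact: (gg w).1.
rewrite -[\sum_(_ <- _) _]subr0; apply/quot_pi_eq; rewrite raddf0 -e raddf_sum.
by apply: eq_bigr => w _; apply: (gg w).2.
Qed.

Definition quot_gmod : gmod :=
  @Gmod (quotmod N) quot_gr quot_gr0 quot_grL quot_grX quot_decomp quot_indep.

Lemma quot_proj_gr u (v : M) : gr u v -> gr (g := quot_gmod) u (quot_pi N v).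
Proof. by move=> gv; exists v. Qed.

Definition quot_proj : ghom M quot_gmod := @Ghom M quot_gmod (quot_pi N) quot_proj_gr.

End SubQuotGmod.

Section KerCoker.
Context (M N : gmod) (f : ghom M N).

Lemma kernel_mem0 : f 0 = 0. Proof. exact: raddf0. Qed.

Lemma kernel_memL a u v : f u = 0 -> f v = 0 -> f (a *: u + v) = 0.
Proof. by move=> eu ev; rewrite linearP eu ev scaler0 addr0. Qed.

Definition kernel_submod : submodule M :=
  Submodule (smem := fun v => f v = 0) kernel_mem0 kernel_memL.

Lemma kernel_hom : homogeneous kernel_submod.
Proof.
move=> s g us gg /=; rewrite raddf_sum => e.
by apply: (gr_indep us _ e) => u; apply: ghom_gr.
Qed.

Definition kernel : gmod := sub_gmod kernel_hom.

Lemma image_mem0 : exists x, f x = 0. Proof. by exists 0; rewrite raddf0. Qed.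

Lemma image_memL a u v : (exists x, f x = u) -> (exists x, f x = v) ->
  exists x, f x = a *: u + v.
Proof. by move=> [x <-] [y <-]; exists (a *: x + y); rewrite linearP. Qed.

Definition image_submod : submodule N :=
  Submodule (smem := fun v => exists x, f x = v) image_mem0 image_memL.

Lemma image_hom : homogeneous image_submod.
Proof.
move=> s g us gg [x ex] u ins.
have [t [h [ut gh eh]]] := gr_decomp x.
exists (if u \in t then h u else 0).
pose k w : N := (if w \in s then g w else 0) - f (if w \in t then h w else 0).
suff: k u = 0 by rewrite /k ins => /subr0_eq.
apply: (gr_indep (s := undup (s ++ t)) (f := k)); rewrite ?undup_uniq //; first 1 last.
- rewrite /k sumrB -raddf_sum -!sum_widen ?undup_uniq // => [|w|w]; first last.
  + by move=> ws; rewrite mem_undup mem_cat ws.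
  + by move=> wt; rewrite mem_undup mem_cat wt orbT.
  by rewrite -ex eh; apply: subrr.
- by rewrite mem_undup mem_cat ins.
move=> w; rewrite /k -scaleN1r addrC -mpolyC1 -mpolyCN; apply: grL.
  by apply: ghom_gr; case: ifP => // _; apply: gr0.
by case: ifP => // _; apply: gr0.
Qed.

Definition coker : gmod := quot_gmod image_hom.

Definition coker_proj : ghom N coker := quot_proj image_hom.

End KerCoker.

(* The ideal <x_1, ..., x_n> of S.                                            *)
Definition irrelevant : submodule S^o :=
  gen_submod (fun p : S^o => exists i : 'I_n, p = 'X_i).

Definition irrelevant_mul (M : gmod) : submodule M :=
  gen_submod (fun v : M => exists2 p : S, irrelevant p & exists w : M, v = p *: w).

Definition exact_at (L M N : gmod) (f : ghom L M) (g : ghom M N) : Prop :=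
  forall v, g v = 0 <-> exists x, f x = v.

Definition gsurj (M N : gmod) (f : ghom M N) : Prop := forall v, exists x, f x = v.

Record presentation (V : gmod) := Presentation {
  pres_1 : gmod;
  pres_0 : gmod;
  pres_map : ghom pres_1 pres_0;
  pres_aug : ghom pres_0 V
}.

Definition free_presentation V (P : presentation V) : Prop :=
  [/\ is_free (pres_1 P), is_free (pres_0 P), gsurj (pres_aug P) &
      exact_at (pres_map P) (pres_aug P)].

(* res_map i is the map from degree i + 1 to degree i.                        *)
Record resolution (V : gmod) := Resolution {
  res_mod : nat -> gmod;
  res_map : forall i, ghom (res_mod i.+1) (res_mod i);
  res_aug : ghom (res_mod 0) V
}.

Definition free_resolution V (R : resolution V) : Prop :=
  [/\ forall i, is_free (res_mod R i), gsurj (res_aug R),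
      exact_at (res_map R 0) (res_aug R) &
      forall i, exact_at (res_map R i.+1) (res_map R i)].

Definition minimal_free_resolution V (R : resolution V) : Prop :=
  free_resolution R /\ forall i x, irrelevant_mul (res_mod R i) (res_map R i x).

Definition minimal_free_presentation V (P : presentation V) : Prop :=
  exists2 R : resolution V, minimal_free_resolution R &
    P = Presentation (res_map R 0) (res_aug R).

Definition gS : gmod := free_gmod (fun _ : unit => 0%MM).

Lemma irrelevantP (p : S) : irrelevant p <-> p@_0%MM = 0.
Proof.
split=> [[s sP ->]|p0].
  rewrite raddf_sum big1_seq //= => -[q r] /= /sP /= [i ->].
  rewrite /GRing.scale /=; apply: memN_msupp_eq0; rewrite (perm_mem (msuppMX _ _)).
  apply/mapP => -[k _] /mnmP/(_ i).
  by rewrite mnm0E mnmDE mnm1E eqxx.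
rewrite [p]mpolyE; apply: (big_ind (fun q : S^o => irrelevant q)).
- exact: smem0.
- by move=> x y hx hy; rewrite -[x]scale1r; apply: smemL.
move=> m _; have [->|mn0] := eqVneq m 0%MM; first by rewrite p0 scale0r; apply: smem0.
have [i mi] : exists i, m i != 0%N.
  apply/existsP; apply: contra_neqT mn0; rewrite negb_exists => /forallP h.
  by apply/mnmP => i; rewrite mnm0E; apply/eqP; have := h i; rewrite negbK.
have -> : p@_m *: 'X_[m] = (p@_m *: 'X_[m - U_(i)] : S^o) *: ('X_i : S^o).
  change (p@_m *: 'X_[m] = p@_m *: 'X_[m - U_(i)] * 'X_i :> S).
  by rewrite -scalerAl -mpolyXD submK // lep1mP.
rewrite -[_ *: _]addr0; apply: smemL; last exact: smem0.
by apply: gen_submod_in; exists i.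
Qed.

Lemma irrelevant_gS v : irrelevant_mul gS v <-> (v tt : S)@_0%MM = 0.
Proof.
split=> [[s sP ->]|v0].
  rewrite sum_ffunE raddf_sum big1_seq //= => -[q r] /= /sP /= [p /irrelevantP p0].
  by case=> w ->; rewrite !ffunE /GRing.scale /= !rmorphM /= p0 mul0r mulr0.
apply: gen_submod_in; exists (v tt : S); first exact/irrelevantP.
exists [ffun _ => 1]; apply/ffunP => -[]; rewrite !ffunE.
by rewrite /GRing.scale /= mulr1.
Qed.

Lemma irrelevant_gS_hom : homogeneous (irrelevant_mul gS).
Proof.
move=> s f us gf /irrelevant_gS e u ins; apply/irrelevant_gS.
have f0 w : w != 0%MM -> (f w tt : S)@_0%MM = 0.
  move=> w0; apply: memN_msupp_eq0; apply/negP => /gf; rewrite addm0 => /eqP.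
  by rewrite eq_sym (negPf w0).
have [u0|/f0 //] := eqVneq u 0%MM.
move: e; rewrite sum_ffunE raddf_sum (bigD1_seq u) //= big1 ?addr0 // => w.
by rewrite u0 => /f0.
Qed.

(* The field F as the graded module S / <x_1, ..., x_n>.                      *)
Definition residue : gmod := quot_gmod irrelevant_gS_hom.

(* The grade u part of M (x)_S N: sums of tensors v (x) w with v, w           *)
(* homogeneous of grades adding up to u.                                      *)
Definition tensor_gr (M N : gmod) (u : grade) (t : tensor M N) : Prop :=
  exists2 s : seq (tensor M N),
    (forall x, x \in s -> exists v w a b,
       [/\ gr (g := M) a v, gr (g := N) b w, (a + b)%MM = u & x = tens v w]) &
    t = \sum_(x <- s) x.

Definition is_basis (T : lmodType S) (U : T -> Prop) d (b : 'I_d -> T) : Prop :=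
  (forall t, U t <-> exists c : 'I_d -> F, t = \sum_i (c i)%:MP *: b i) /\
  (forall c : 'I_d -> F, \sum_i (c i)%:MP *: b i = 0 -> forall i, c i = 0).

(* The F-dimension of U; by convention 0 if it is infinite, which does not    *)
(* occur for the graded parts of finitely generated modules.                  *)
Definition fdim (T : lmodType S) (U : T -> Prop) : nat :=
  match excluded_middle_informative (exists d, exists b : 'I_d -> T, is_basis U b) with
  | left ex => proj1_sig (constructive_indefinite_description _ ex)
  | right _ => 0%N
  end.

Definition xi0 (V : gmod) (u : grade) : nat := fdim (@tensor_gr V residue u).

Definition supp_xi0 (V : gmod) (u : grade) : Prop := xi0 V u <> 0%N.

End Graded.

Record cell_complex (F : fieldType) := CellComplex {
  cell :> finType;
  cdim : cell -> nat;
  kappa : cell -> cell -> F;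
  kappa_dim : forall t s, kappa t s != 0 -> cdim t = (cdim s).+1;
  kappa_kappa : forall t s, \sum_(r : cell) kappa t r * kappa r s = 0
}.

Section Cells.
Context (F : fieldType) (X : cell_complex F).

Definition facet : rel X := fun s t => kappa t s != 0.

Definition face : rel X := connect facet.

Definition subcomplex (A : {set X}) : Prop :=
  forall s t, face s t -> t \in A -> s \in A.

End Cells.

Record filtration (F : fieldType) (n : nat) (X : cell_complex F) := Filtration {
  fil :> 'X_{1..n} -> {set X};
  fil_sub : forall u, subcomplex (fil u);
  fil_mono : forall u v, (u <= v)%MM -> fil u \subset fil v
}.

Section FilteredComplex.
Context (F : fieldType) (n : nat) (X : cell_complex F) (K : filtration n X).
Local Notation S := {mpoly F[n]}.
Local Notation grade := 'X_{1..n}.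

Definition exhaustive : Prop := forall s : X, exists u, s \in K u.

Definition one_critical : Prop :=
  exists2 h : X -> grade, (forall s t, face s t -> (h s <= h t)%MM) &
    forall u, K u = [set s | (h s <= u)%MM].

(* K (u - U_(j)) stands for the empty set when u j = 0.                       *)
Definition entrance_grade (s : X) (u : grade) : Prop :=
  s \in K u /\ forall j : 'I_n, (0 < u j)%N -> s \notin K (u - U_(j))%MM.

Definition entrance_grades (q : nat) (u : grade) : Prop :=
  exists2 s : X, cdim s = q & entrance_grade s u.

(* C_q(A), for A a subset of X, inside the space of all chains of X; q is an  *)
(* int because of C_(-1) = 0.                                                 *)
Definition in_chains (q : int) (A : {set X}) (c : {ffun X -> F}) : Prop :=
  forall s, c s != 0 -> (cdim s)%:Z = q /\ s \in A.

Definition all_chains : gmod F n := free_gmod F (fun _ : X => 0%MM).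

Definition slice (c : all_chains) (u : grade) : {ffun X -> F} :=
  [ffun s => (c s : S)@_u].

(* C_q, the direct sum over u of the C_q(K u), with the finitely supported    *)
(* family (c_u)_u encoded by s |-> \sum_u c_u(s) x^u. Multiplication by x_i   *)
(* is then the inclusion of C_q(K u) into C_q(K (u + e_i)).                   *)
Definition in_chainmod (q : int) (c : all_chains) : Prop :=
  forall u, in_chains q (K u) (slice c u).

Lemma in_chainmod0 q : in_chainmod q 0.
Proof. by move=> u s; rewrite !ffunE mcoeff0 eqxx. Qed.

Lemma in_chainmodL q a v w :
  in_chainmod q v -> in_chainmod q w -> in_chainmod q (a *: v + w).
Proof.
move=> hv hw u s; rewrite !ffunE mcoeffD.
have [->|wn] := eqVneq ((w s : S)@_u) 0; last first.
  by move=> _; apply: (hw u s); rewrite ffunE.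
rewrite addr0 -mcoeff_msupp => /msuppM_le/allpairsP[[k m] /= [_ ms eu]].
have [|? sK] := hv m s; first by rewrite ffunE -mcoeff_msupp.
by split=> //; apply: (subsetP (fil_mono K _)) sK; rewrite eu lem_addl.
Qed.

Definition chain_submod (q : int) : submodule all_chains :=
  Submodule (@in_chainmod0 q) (@in_chainmodL q).

Lemma chain_hom q : homogeneous (chain_submod q).
Proof.
move=> t f ut gf h u uint w s; rewrite ffunE => nz.
have eu : w = u by rewrite -(gf u s w) ?addm0 // mcoeff_msupp.
apply: h; rewrite ffunE sum_ffunE raddf_sum (bigD1_seq u) //= big1 ?addr0 //.
move=> k ku; apply: memN_msupp_eq0; apply/negP => /gf; rewrite addm0 eu => /eqP.
by rewrite eq_sym (negPf ku).
Qed.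

Definition chainmod (q : int) : gmod F n := sub_gmod (@chain_hom q).

Definition bd_fun (c : all_chains) : all_chains :=
  [ffun s => \sum_(t : X) (kappa t s)%:MP * c t].

Lemma bd_fun_slice c u s : slice (bd_fun c) u s = \sum_(t : X) kappa t s * slice c u t.
Proof.
by rewrite !ffunE raddf_sum; apply: eq_bigr => t _; rewrite ffunE /= mcoeffCM.
Qed.

Lemma bd_fun_linear : linear bd_fun.
Proof.
move=> a v w; apply/ffunP => s; rewrite !ffunE /GRing.scale /= mulr_sumr -big_split /=.
apply: eq_bigr => t _; rewrite !ffunE mulrDr; congr (_ + _).
by rewrite /GRing.scale /= mulrCA.
Qed.

HB.instance Definition _ := GRing.isLinear.Build S all_chains all_chains *:%R bd_fun bd_fun_linear.

Lemma bd_fun_gr u v : gr u v -> gr u (bd_fun v).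
Proof.
move=> gv s m; rewrite ffunE mcoeff_msupp raddf_sum => nz.
have [t nt] : exists t, (v t : S)@_m != 0.
  apply/existsP; apply: contra_neqT nz; rewrite negb_exists => /forallP h.
  rewrite big1 // => t _; have := h t; rewrite negbK /= mcoeffCM => /eqP->.
  by rewrite mulr0.
by apply: (gv t m); rewrite mcoeff_msupp.
Qed.

Lemma bd_fun_bd c : bd_fun (bd_fun c) = 0.
Proof.
apply/ffunP => s; rewrite !ffunE.
under eq_bigr do rewrite ffunE mulr_sumr.
rewrite exchange_big big1 //= => t _.
rewrite (eq_bigr (fun r => (kappa t r * kappa r s)%:MP * c t)) => [|r _]; last first.
  by rewrite mulrA -mpolyCM mulrC [kappa r s * _]mulrC mulrC.
by rewrite -mulr_suml -raddf_sum kappa_kappa raddf0 mul0r.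
Qed.

Section Boundary.
Context (q r : int) (eqr : q = r + 1).

Lemma bd_chain (c : chainmod q) : smem (chain_submod r) (bd_fun (val c)).
Proof.
move=> u s; rewrite bd_fun_slice => nz.
have [t] : exists t, kappa t s * slice (val c) u t != 0.
  apply/existsP; apply: contra_neqT nz; rewrite negb_exists => /forallP h.
  by rewrite big1 // => t _; apply/eqP; have := h t; rewrite negbK.
rewrite mulf_eq0 negb_or => /andP[kn cn].
have [dt tK] := submodP c u t cn; split; last first.
  by apply: (fil_sub _ tK); apply: connect1.
by move: dt; rewrite eqr (kappa_dim kn) -addn1 PoszD => /addIr.
Qed.

Arguments bd_chain : clear implicits.

Definition bdm_fun (c : chainmod q) : chainmod r := @mk_submod _ _ (chain_submod r) (bd_fun (val c)) (bd_chain c).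

Lemma bdm_linear : linear bdm_fun.
Proof. by move=> a v w; apply: val_inj; rewrite /= !linearP. Qed.

HB.instance Definition _ :=
  GRing.isLinear.Build S (chainmod q) (chainmod r) *:%R bdm_fun bdm_linear.

Lemma bdm_gr u v : gr u v -> gr u (bdm_fun v).
Proof. exact: bd_fun_gr. Qed.

Definition bdm : ghom (chainmod q) (chainmod r) :=
  @Ghom _ _ (chainmod q) (chainmod r) bdm_fun bdm_gr.

End Boundary.

Definition boundary (q : int) : ghom (chainmod q) (chainmod (q - 1)) :=
  bdm (esym (subrK 1 q)).

Definition cycles (q : int) : gmod F n := kernel (boundary q).

Section BoundaryToCycles.
Context (q : int).
Local Notation d := (bdm (erefl (q + 1))).

Lemma bd_cycle c : kernel_submod (boundary q) (d c).
Proof. by apply: val_inj; rewrite /= bd_fun_bd. Qed.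

Definition bdc_fun (c : chainmod (q + 1)) : cycles q := @mk_submod _ _ (kernel_submod (boundary q)) (d c) (bd_cycle c).

Lemma bdc_linear : linear bdc_fun.
Proof. by move=> a v w; apply: val_inj; rewrite /= !linearP. Qed.

HB.instance Definition _ :=
  GRing.isLinear.Build S (chainmod (q + 1)) (cycles q) *:%R bdc_fun bdc_linear.

Lemma bdc_gr u v : gr u v -> gr u (bdc_fun v).
Proof. exact: (ghom_gr d). Qed.

Definition boundary_cycles : ghom (chainmod (q + 1)) (cycles q) :=
  @Ghom _ _ (chainmod (q + 1)) (cycles q) bdc_fun bdc_gr.

End BoundaryToCycles.

Definition homology (q : int) : gmod F n := coker (boundary_cycles q).

Definition homology_proj (q : int) : ghom (cycles q) (homology q) :=
  coker_proj (boundary_cycles q).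

End FilteredComplex.

Definition join_closure n (G : 'X_{1..n} -> Prop) (u : 'X_{1..n}) : Prop :=
  exists L : seq 'X_{1..n},
    [/\ L <> [::], forall w, w \in L -> G w & u = \big[@mlcm n/0%MM]_(w <- L) w].

(* Main.v *)
Require Import Defs.
From Stdlib Require Import Classical ClassicalEpsilon.
From HB Require Import structures.
From mathcomp Require Import all_boot all_order all_algebra.
From mathcomp Require Import mpoly.

(* Let M -> N -> P be exact at N, with M and N free, P torsion-free and       *)
(* ker (M -> N) inside <x_1, ..., x_n> M. Given a grade u, let u' be the join *)
(* of the generator grades of N below u. Every element of N of grade u is     *)
(* x^(u - u') y, and if it is a cycle then so is y, as P is torsion-free. If  *)
(* u' <> u this shows that M needs no generator of grade u; hence the         *)
(* generator grades of M are joins of those of N. This applies to             *)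
(* F0 -> C_q -> C_(q-1) and then to F1 -> F0 -> ker d_q.                      *)

Import GRing.Theory.
Local Open Scope ring_scope.
Set Implicit Arguments.
Unset Strict Implicit.

(** Both inclusions reduce to generator grades: tensoring with the residue field kills every grade
    in which a free module has no generator ([supp_xi0_free]). One-criticality makes C_q free on the
    q-cells, each placed at its entrance grade ([chainmod_free]), which settles the summand C_(q+1).
    For F0 and F1 the key is [minimal_generators_join]. By exactness and minimality of the
    resolution, the kernels of [eps] and [phi1] consist of combinations of multiples of the
    variables, so a generator never has the same image as such a combination; dividing its image by
    x^(u - u') and lifting the quotient would produce just that. The modules C_(q-1) and ker d_q are
    torsion-free as submodules of free ones. The second application gives joins of joins, which
    [join_closure_join] flattens. *)

(** * Joins of grades *)

Section Joins.
Context (n : nat).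
Implicit Types (u v w : 'X_{1..n}) (L : seq 'X_{1..n}).

Lemma mlcmA : associative (@mlcm n).
Proof. by move=> u v w; apply/mnmP => i; rewrite !mnmE maxnA. Qed.

HB.instance Definition _ :=
  Monoid.isLaw.Build 'X_{1..n} 0%MM (@mlcm n) mlcmA (@mlc0m n) (@mlcm0 n).

Lemma lem0m u : (0%MM <= u)%MM.
Proof. by apply/mnm_lepP => i; rewrite mnm0E. Qed.

Lemma big_mlcm_le u L :
  (forall w, w \in L -> (w <= u)%MM) -> (\big[@mlcm n/0%MM]_(w <- L) w <= u)%MM.
Proof.
elim: L => [|w L IH] leL; first by rewrite big_nil lem0m.
rewrite big_cons lem_mlcm leL ?mem_head //= IH // => v vL.
by rewrite leL // inE vL orbT.
Qed.

Lemma le_big_mlcm u L : u \in L -> (u <= \big[@mlcm n/0%MM]_(w <- L) w)%MM.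
Proof.
elim: L => // w L IH; rewrite inE big_cons => /orP[/eqP->|/IH le_u].
  exact: lem_mlcml.
exact: lepm_trans le_u (lem_mlcmr _ _).
Qed.

(** A join of joins is the join of the concatenated lists. The induction starts at singletons
    because the lists must stay nonempty. *)
Lemma join_closure_join (G G' : 'X_{1..n} -> Prop) u :
  (forall w, G w -> join_closure G' w) -> join_closure G u -> join_closure G' u.
Proof.
move=> GG' [[|w L] [Ln GL ->]] //; elim: L w {Ln} GL => [|v L IH] w GL.
  by rewrite big_seq1; apply/GG'/GL/mem_head.
rewrite big_cons; have [L1 [L1n GL1 ->]] := GG' _ (GL w (mem_head _ _)).
have [|L2 [L2n GL2 ->]] := IH v; first by move=> x xL; apply: GL; rewrite inE xL orbT.
rewrite -big_cat; exists (L1 ++ L2); split=> // [|x]; first by case: L1 L1n {GL1}.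
by rewrite mem_cat => /orP[/GL1|/GL2].
Qed.

End Joins.

(** * Multiples of the variables, and isomorphisms of graded modules *)

Section GradedModules.
Context (F : fieldType) (n : nat).
Local Notation S := {mpoly F[n]}.
Local Notation grade := 'X_{1..n}.

Lemma mpolyX_neq0 (m : grade) : 'X_[m] != 0 :> S.
Proof. by rewrite -msupp_eq0 msuppX. Qed.

Lemma mpolyX_dvd (m : grade) (p : S) :
  (forall k, k \in msupp p -> (m <= k)%MM) -> exists r, p = 'X_[m] * r.
Proof.
move=> le_m; exists (\sum_(k <- msupp p) p@_k *: 'X_[k - m]).
rewrite [LHS]mpolyE mulr_sumr; apply: eq_big_seq => k /le_m le_mk.
by rewrite -scalerAr -mpolyXD addmC submK.
Qed.

Lemma irrelevantX (m : grade) : m != 0%MM -> irrelevant F n 'X_[m].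
Proof. by move=> /negPf m0; apply/irrelevantP; rewrite mcoeffX m0. Qed.

Lemma smemD (R : comNzRingType) (V : lmodType R) (N : submodule V) x y :
  N x -> N y -> N (x + y).
Proof. by move=> Nx Ny; rewrite -[x]scale1r; apply: smemL. Qed.

Lemma smem_sum (R : comNzRingType) (V : lmodType R) (N : submodule V)
    (I : Type) (s : seq I) (f : I -> V) :
  (forall i, N (f i)) -> N (\sum_(i <- s) f i).
Proof.
by move=> Nf; apply: big_ind => //; [apply: smem0 | apply: smemD].
Qed.

Lemma irrelevant_mulZ (M : gmod F n) (p : S) (w : M) :
  irrelevant F n p -> irrelevant_mul M (p *: w).
Proof. by move=> ip; apply: gen_submod_in; exists p => //; exists w. Qed.

Lemma ghomZ (M N : gmod F n) (f : ghom M N) (p : S) (v : M) :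
  f (p *: v) = p *: f v.
Proof. exact: linearZ_LR. Qed.

Lemma ghom_irrelevant_mul (M N : gmod F n) (f : ghom M N) v :
  irrelevant_mul M v -> irrelevant_mul N (f v).
Proof.
case=> s sP ->; rewrite raddf_sum big_seq.
apply: (big_ind (fun x => irrelevant_mul N x)); [exact: smem0|exact: smemD|].
move=> [c x] /sP /= [r ir [w ->]].
have irr_cr : irrelevant F n (c * r).
  by apply/irrelevantP; rewrite rmorphM /= (proj1 (irrelevantP _) ir) mulr0.
have := irrelevant_mulZ (f w) irr_cr.
by congr (irrelevant_mul _ _); rewrite -scalerA -!ghomZ.
Qed.

Lemma giso_sym (M N : gmod F n) : giso M N -> giso N M.
Proof. by case=> f [g [fK gK]]; exists g, f. Qed.

Lemma giso_trans (M N P : gmod F n) : giso M N -> giso N P -> giso M P.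
Proof.
case=> f [f' [fK f'K]] [g [g' [gK g'K]]].
by exists (gcomp g f), (gcomp f' g'); split=> x /=; rewrite ?gK ?fK ?f'K ?g'K.
Qed.

Section GisoOfBij.
Context (M N : gmod F n) (f : M -> N).
Context (f_lin : linear f) (f_inj : injective f).
Context (f_surj : forall y, exists x, f x = y).
Context (f_gr : forall u x, gr u (f x) <-> gr u x).

HB.instance Definition _ := GRing.isLinear.Build S M N *:%R f f_lin.

Lemma ghom_of_bij_gr u x : gr u x -> gr u (f x). Proof. by move/f_gr. Qed.

(** The inverse is built by choosing preimages; injectivity makes it linear, and the equivalence in
    [f_gr] makes it preserve grades. *)
Lemma giso_of_bij : giso M N.
Proof.
have ex y : exists x, f x == y by have [x <-] := f_surj y; exists x.
pose g y := xchoose (ex y).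
have gK : cancel g f by move=> y; apply/eqP/(xchooseP (ex y)).
have fK : cancel f g by move=> x; apply: f_inj; rewrite gK.
have g_lin : linear g by move=> c x y; apply: f_inj; rewrite f_lin !gK.
pose gl := GRing.isLinear.Build S N M *:%R g g_lin.
pose gL : {linear N -> M} := HB.pack g gl.
have g_gr u y : gr u y -> gr u (gL y) by move=> gy; apply/f_gr; rewrite /= gK.
by exists (@Ghom _ _ M N f ghom_of_bij_gr), (@Ghom _ _ N M gL g_gr); split.
Qed.

End GisoOfBij.

Lemma free_giso_reindex (I J : finType) (a : I -> grade) (k : J -> I) :
  bijective k -> giso (free_gmod F a) (free_gmod F (fun j => a (k j))).
Proof.
case=> k' kK k'K.
pose f (v : free_gmod F a) : free_gmod F (fun j => a (k j)) := [ffun j => v (k j)].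
apply: (giso_of_bij (f := f)).
- by move=> c v w; apply/ffunP => j; rewrite !ffunE.
- move=> v w /ffunP e; apply/ffunP => i; have := e (k' i).
  by rewrite !ffunE k'K.
- move=> w; exists [ffun i => w (k' i)]; apply/ffunP => j.
  by rewrite !ffunE kK.
- move=> u v; split=> gv i m; last by rewrite ffunE => /gv.
  by move=> ms; rewrite -[i]k'K; apply: gv; rewrite ffunE k'K.
Qed.

(** Bases are naturally indexed by cells or by sum types, whereas [is_free] asks for an ordinal;
    [enum_val] passes between the two. *)
Lemma is_free_of_giso (I : finType) (a : I -> grade) (M : gmod F n) :
  giso M (free_gmod F a) -> is_free M.
Proof.
move=> isoM; exists #|I|, (fun j => a (enum_val j)).
by apply: giso_trans isoM _; apply/free_giso_reindex/enum_val_bij.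
Qed.

Lemma dsum_giso_free (I J : finType) (a : I -> grade) (b : J -> grade)
    (M N : gmod F n) :
  giso M (free_gmod F a) -> giso N (free_gmod F b) ->
  giso (dsum M N)
    (free_gmod F (fun k : I + J => match k with inl i => a i | inr j => b j end)).
Proof.
case=> f [f' [fK f'K]] [g [g' [gK g'K]]].
set c := fun k : I + J => _.
pose h (x : dsum M N) : free_gmod F c :=
  [ffun k => match k with inl i => f x.1 i | inr j => g x.2 j end].
have h1 x i : h x (inl i) = f x.1 i by rewrite ffunE.
have h2 x j : h x (inr j) = g x.2 j by rewrite ffunE.
apply: (giso_of_bij (f := h)).
- move=> r x y; apply/ffunP => -[i|j]; rewrite !ffunE /= ?h1 ?h2 linearP !ffunE //.
- move=> x y /ffunP e; apply: injective_projections.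
    apply: (can_inj fK); apply/ffunP => i; by have := e (inl i); rewrite !h1.
  by apply: (can_inj gK); apply/ffunP => j; have := e (inr j); rewrite !h2.
- move=> y; exists (f' [ffun i => y (inl i)], g' [ffun j => y (inr j)]).
  by apply/ffunP => -[i|j]; rewrite ffunE /= ?f'K ?g'K ffunE.
- move=> u x; split=> [gh|[gx1 gx2] [i|j] m]; last first.
  + by rewrite h2 => /(ghom_gr g gx2).
  + by rewrite h1 => /(ghom_gr f gx1).
  split; [rewrite -[x.1]fK|rewrite -[x.2]gK]; apply: ghom_gr => i m ms.
    by apply: (gh (inl i)); rewrite h1.
  by apply: (gh (inr i)); rewrite h2.
Qed.

(** * Free modules and the grades of their generators *)

Section FreeModules.
Context (I : finType) (a : I -> grade).
Local Notation FM := (free_gmod F a).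

Definition free_gen (i : I) : FM := [ffun j => (j == i)%:R].

Lemma free_gen_gr i : gr (a i) (free_gen i).
Proof.
move=> j m; rewrite ffunE; case: eqP => [->|_]; last by rewrite msupp0.
by rewrite msupp1 inE => /eqP->; rewrite add0m.
Qed.

Lemma free_irrelevant_mulP (v : FM) :
  irrelevant_mul FM v <-> forall i, (v i : S)@_0%MM = 0.
Proof.
split=> [[s sP ->] i|v0].
  rewrite sum_ffunE raddf_sum big1_seq //= => -[q r] /= /sP /= [p /irrelevantP p0].
  by case=> w ->; rewrite !ffunE /GRing.scale /= !rmorphM /= p0 mul0r mulr0.
have -> : v = \sum_i (v i : S) *: free_gen i.
  apply/ffunP => i; rewrite sum_ffunE (bigD1 i) //= big1 => [|j ji].
    by rewrite !ffunE eqxx addr0 /GRing.scale /= mulr1.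
  by rewrite !ffunE eq_sym (negPf ji) scaler0.
by apply: smem_sum => i; apply/irrelevant_mulZ/irrelevantP.
Qed.

Lemma free_gen_not_irrelevant i : ~ irrelevant_mul FM (free_gen i).
Proof.
move/free_irrelevant_mulP/(_ i)/eqP; rewrite ffunE eqxx mcoeff1 eqxx.
exact/negP/oner_neq0.
Qed.

Context (M : gmod F n) (isoM : giso M FM).

(** A coordinate of an element of grade u only has exponents m with m + a i = u, so a constant term
    forces a i = u. *)
Lemma free_irrelevant_grade u v :
  (forall i, a i <> u) -> gr (g := M) u v -> irrelevant_mul M v.
Proof.
case: isoM => f [g [fK gK]] au gv; rewrite -[v]fK; apply: ghom_irrelevant_mul.
apply/free_irrelevant_mulP => i; apply: memN_msupp_eq0; apply/negP => ms.
by apply: (au i); have := ghom_gr f gv _ _ ms; rewrite add0m.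
Qed.

Lemma free_grade_eq0 u v :
  (forall i, ~~ (a i <= u)%MM) -> gr (g := M) u v -> v = 0.
Proof.
case: isoM => f [g [fK gK]] au gv; rewrite -[v]fK -[RHS](raddf0 g); congr (g _).
apply/ffunP => i; rewrite ffunE; apply/eqP; rewrite -msupp_eq0.
case E: (msupp _) => [//|m s]; have ms : m \in msupp (f v i) by rewrite E mem_head.
by have /negP[] := au i; rewrite -(ghom_gr f gv _ _ ms) lem_addl.
Qed.

(** A nonzero i-th coordinate has exponent u - a i, and a i <= u' makes this at least u - u'. *)
Lemma free_grade_dvd u u' v :
  (u' <= u)%MM -> (forall i, (a i <= u)%MM -> (a i <= u')%MM) ->
  gr (g := M) u v -> exists v', v = 'X_[u - u'] *: v'.
Proof.
case: isoM => f [g [fK gK]] le_u au gv.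
have [i|w wP] := @fin_all_exists I (fun _ => S)
    (fun i r => f v i = 'X_[u - u'] * r).
  apply: mpolyX_dvd => m ms; have eu := ghom_gr f gv _ _ ms.
  have : (a i <= u')%MM by apply: au; rewrite -eu lem_addl.
  rewrite -eu => /mnm_lepP le_a; apply/mnm_lepP => j.
  by have := le_a j; rewrite mnmBE mnmDE leq_subLR addnC leq_add2r.
exists (g [ffun i => w i]); rewrite -linearZ -[LHS]fK; congr (g _).
by apply/ffunP => i; rewrite wP !ffunE.
Qed.

End FreeModules.

Definition torsion_free (M : gmod F n) : Prop :=
  forall (p : S) (v : M), p != 0 -> p *: v = 0 -> v = 0.

Lemma free_torsion_free (I : finType) (a : I -> grade) :
  torsion_free (free_gmod F a).
Proof.
move=> p v p0 /ffunP e; apply/ffunP => i; have /eqP := e i.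
by rewrite !ffunE mulf_eq0 (negPf p0) => /eqP.
Qed.

Lemma sub_torsion_free (M : gmod F n) (N : submodule M) (homN : homogeneous N) :
  torsion_free M -> torsion_free (sub_gmod homN).
Proof.
move=> tfM p v p0 /(congr1 val); rewrite linearZ raddf0 => /(tfM _ _ p0) e.
by apply: val_inj; rewrite e raddf0.
Qed.

(* If no b j lies below u = a i, the join u' of the empty family is 0, which  *)
(* may equal u; in that case the part of N of grade u is 0.                   *)
Lemma minimal_generators_join (I J : finType) (a : I -> grade) (b : J -> grade)
    (M N P : gmod F n) (f : ghom M N) (g : ghom N P) :
  giso M (free_gmod F a) -> giso N (free_gmod F b) -> torsion_free P ->
  exact_at f g -> (forall x, f x = 0 -> irrelevant_mul M x) ->
  forall i, join_closure (fun w => exists j, w = b j) (a i).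
Proof.
move=> isoM isoN tfP exfg minf i.
case: (isoM) => fM [gM [_ gMK]]; pose e := gM (free_gen a i).
have ge : gr (g := M) (a i) e by apply/ghom_gr/free_gen_gr.
(* Otherwise e - z lies in the kernel, so e would be a combination of multiples of the variables,
   which a generator is not. *)
have noz z : irrelevant_mul M z -> f e <> f z.
  move=> iz efz; apply: (@free_gen_not_irrelevant _ a i).
  rewrite -[free_gen _ _]gMK; apply: ghom_irrelevant_mul.
  rewrite -[gM _](subrK z); apply: smemD => //; apply: minf.
  by rewrite raddfB /= efz subrr.
set u := a i in ge *; pose L := [seq b j | j <- enum J & (b j <= u)%MM].
pose u' := \big[@mlcm n/0%MM]_(w <- L) w.
have inL j : (b j <= u)%MM -> b j \in L.
  by move=> le_b; apply: map_f; rewrite mem_filter le_b mem_enum.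
have le_u : (u' <= u)%MM.
  by apply: big_mlcm_le => w /mapP[j]; rewrite mem_filter => /andP[? _] ->.
have gfe : gr (g := N) u (f e) by apply: ghom_gr.
have [L0|Ln] := eqVneq L [::].
  case: (noz 0); first exact: smem0.
  rewrite raddf0; apply: (free_grade_eq0 isoN) gfe => j.
  by apply/negP => /inL; rewrite L0.
have [eu|nu] := eqVneq u u'.
  exists L; split=> // [|w /mapP[j _ ->]]; [exact/eqP|by exists j].
have [|v' ev] := free_grade_dvd isoN le_u _ gfe.
  by move=> j /inL; apply: le_big_mlcm.
(* x^(u - u') kills g v', because its multiple of v' is the image f e; torsion-freeness then gives g
   v' = 0. *)
have [z' ez] : exists z, f z = v'.
  apply/exfg; apply: (tfP ('X_[u - u'])); first exact: mpolyX_neq0.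
  by rewrite -linearZ -ev; apply/exfg; exists e.
case: (noz ('X_[u - u'] *: z')); last by rewrite linearZ ez.
apply/irrelevant_mulZ/irrelevantX; apply: contra_neq nu => u0.
by rewrite -(submK le_u) u0 add0m.
Qed.

End GradedModules.

(** * Bilinearity of the tensor product *)

Section TensorTheory.
Context (R : comNzRingType) (M N : lmodType R).

Lemma tens_linear_l w : linear (fun v : M => tens v w : tensor M N).
Proof.
move=> c u v; rewrite /tens -[RHS](linearP (quot_pi _)); apply/quot_pi_eq.
exact/gen_submod_in/tensor_rel_l.
Qed.

Lemma tens_linear_r v : linear (fun w : N => tens v w : tensor M N).
Proof.
move=> c u w; rewrite /tens -[RHS](linearP (quot_pi _)); apply/quot_pi_eq.
exact/gen_submod_in/tensor_rel_r.
Qed.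

Lemma tens0l w : tens (0 : M) w = 0 :> tensor M N.
Proof.
(* The scalar -1 makes the right-hand side t - t with reversed signs, hence 0. *)
by have := tens_linear_l w (-1) 0 0; rewrite !scaleN1r !addNr.
Qed.

Lemma tens0r v : tens v (0 : N) = 0 :> tensor M N.
Proof.
by have := tens_linear_r v (-1) 0 0; rewrite !scaleN1r !addNr.
Qed.

Lemma tensZl c v w : tens (c *: v : M) w = c *: tens v w :> tensor M N.
Proof. by have := tens_linear_l w c v 0; rewrite tens0l !addr0. Qed.

Lemma tensZr c v w : tens v (c *: w : N) = c *: tens v w :> tensor M N.
Proof. by have := tens_linear_r v c w 0; rewrite tens0r !addr0. Qed.

Lemma tensDl u v w : tens (u + v : M) w = tens u w + tens v w :> tensor M N.
Proof. by have := tens_linear_l w 1 u v; rewrite !scale1r. Qed.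

End TensorTheory.

(** * The support of xi_0 of a free module *)

Section Betti.
Context (F : fieldType) (n : nat).
Local Notation S := {mpoly F[n]}.
Local Notation grade := 'X_{1..n}.

Lemma irrelevant_residue (p : S) (w : residue F n) : irrelevant F n p -> p *: w = 0.
Proof.
move=> ip; have [v <-] := quot_pi_surj w.
rewrite -[LHS](linearZ_LR (quot_pi _)) -[RHS](raddf0 (quot_pi _)); apply/quot_pi_eq.
by rewrite subr0; apply: irrelevant_mulZ.
Qed.

(** The residue field lives in grade 0: any other grade has representatives without constant
    term. *)
Lemma residue_gr_eq0 (b : grade) (w : residue F n) : b != 0%MM -> gr b w -> w = 0.
Proof.
move=> b0 [v gv <-]; rewrite -[RHS](raddf0 (quot_pi _)); apply/quot_pi_eq.
rewrite subr0; apply/irrelevant_gS/memN_msupp_eq0/negP => /gv.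
by rewrite addm0 => /esym/eqP; apply/negP.
Qed.

(** A coefficient from the ideal of the variables moves across the tensor sign and kills the residue
    field. *)
Lemma tens_residue_eq0 (M : gmod F n) (v : M) (w : residue F n) :
  irrelevant_mul M v -> tens v w = 0.
Proof.
case=> s sP ->; rewrite big_seq.
apply: (big_ind (fun x => tens x w = 0)); first exact: tens0l.
  by move=> x y ex ey; rewrite tensDl ex ey addr0.
move=> [c x] /sP /= [r ir [y ->]].
by rewrite !tensZl -tensZr irrelevant_residue // tens0r scaler0.
Qed.

(** [fdim] picks some size for which a basis exists, so every possible basis has to be shown empty:
    a first basis vector would be 0, against independence. *)
Lemma fdim_trivial (T : lmodType S) (U : T -> Prop) :
  (forall t, U t -> t = 0) -> fdim U = 0%N.
Proof.
move=> U0; rewrite /fdim; case: excluded_middle_informative => // ex.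
case: constructive_indefinite_description => -[//|d] /= [b [Ub indep]].
pose c (i : 'I_d.+1) : F := (i == ord0)%:R.
have cb : \sum_i (c i)%:MP *: b i = b ord0.
  rewrite (bigD1 ord0) //= mpolyC1 scale1r big1 ?addr0 // => i /negPf i0.
  by rewrite /c i0 mpolyC0 scale0r.
have b0 : b ord0 = 0 by apply/U0/Ub; exists c.
by have /eqP := indep c (etrans cb b0) ord0; rewrite /c eqxx oner_eq0.
Qed.

Lemma supp_xi0_free (I : finType) (a : I -> grade) (M : gmod F n) u :
  giso M (free_gmod F a) -> supp_xi0 M u -> exists i, a i = u.
Proof.
move=> isoM xiu; apply: NNPP => nau; apply: xiu; apply: fdim_trivial => t.
case=> s sP ->; rewrite big_seq; apply: big1 => x /sP [v [w [c [d [gv gw cd ->]]]]].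
have [d0|d0] := eqVneq d 0%MM; last by rewrite (residue_gr_eq0 d0 gw) tens0r.
apply: tens_residue_eq0; apply: (free_irrelevant_grade isoM) gv => i ai.
by apply: nau; exists i; rewrite ai -cd d0 addm0.
Qed.

End Betti.

(** * Chain modules of a one-critical filtration *)

Section Cells.
Context (F : fieldType) (n : nat) (X : cell_complex F) (K : filtration n X).
Local Notation S := {mpoly F[n]}.

(** In the encoding of chains, the coefficient at a q-cell s ranges over the ideal generated by x^(h
    s), a copy of S(-h s); the isomorphism multiplies each coordinate by x^(h s). *)
Lemma chainmod_free (h : X -> 'X_{1..n}) (q : int) :
  (forall u, K u = [set s | (h s <= u)%MM]) ->
  giso (chainmod K q) (free_gmod F (fun s : {s : X | (cdim s)%:Z == q} => h (val s))).
Proof.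
move=> Kh; pose I : finType := {s : X | (cdim s)%:Z == q}; apply: giso_sym.
pose g (v : free_gmod F (fun s : I => h (val s))) : all_chains n X :=
  [ffun s => if insub s is Some i then 'X_[h s] * (v i : S) else 0].
have gI v i : g v (val i) = 'X_[h (val i)] * v i by rewrite ffunE valK.
have gC v : smem (chain_submod K q) (g v).
  move=> u s; rewrite !ffunE; case: insubP => [i dim_s si|]; last by rewrite mcoeff0 eqxx.
  rewrite -mcoeff_msupp mulrC (perm_mem (msuppMX _ _)) => /mapP[m _ ->].
  by split; [exact/eqP|rewrite Kh inE lem_addr].
pose f v : chainmod K q := mk_submod (gC v).
apply: (giso_of_bij (f := f)).
- move=> c v w; apply: val_inj; rewrite linearP /=; apply/ffunP => s; rewrite !ffunE.
  case: insubP => [i _ _|_]; last by rewrite scaler0 addr0.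
  by rewrite !ffunE mulrDr; congr (_ + _); rewrite /GRing.scale /= mulrCA.
- move=> v w /(congr1 val) /= /ffunP e; apply/ffunP => i.
  by have := e (val i); rewrite !gI; apply: mulfI; apply: mpolyX_neq0.
- move=> y; have [i|v vP] := @fin_all_exists I (fun _ => S)
      (fun i r => val y (val i) = 'X_[h (val i)] * r).
    apply: mpolyX_dvd => m ms; have [|_] := submodP y m (val i).
      by rewrite ffunE -mcoeff_msupp.
    by rewrite Kh inE.
  exists [ffun i => v i]; apply: val_inj; apply/ffunP => s; rewrite /= ffunE.
  case: insubP => [i _ <-|dim_s]; first by rewrite ffunE vP.
  apply/esym/mpolyP => m; rewrite mcoeff0; apply/eqP/negPn/negP => nz.
  have [|dq _] := submodP y m s; first by rewrite ffunE.
  by rewrite dq eqxx in dim_s.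
- move=> u v; split=> gv.
    move=> i m ms; rewrite -[RHS](gv (val i) (m + h (val i))%MM) ?addm0 // /= gI.
    by rewrite mulrC (perm_mem (msuppMX _ _)) addmC; apply: map_f.
  move=> s m /=; rewrite ffunE; case: insubP => [i _ si|_]; last by rewrite msupp0.
  rewrite mulrC (perm_mem (msuppMX _ _)) => /mapP[k /gv <- ->].
  by rewrite addm0 addmC si.
Qed.

Lemma chainmod_torsion_free q : torsion_free (chainmod K q).
Proof. exact/sub_torsion_free/free_torsion_free. Qed.

Lemma entrance_gradeP (h : X -> 'X_{1..n}) s :
  (forall u, K u = [set s | (h s <= u)%MM]) -> entrance_grade K s (h s).
Proof.
move=> Kh; split=> [|j hj]; rewrite Kh inE ?lepm_refl //.
(* Subtraction of exponents is truncated, so [hj] is what makes the j-th coordinate drop. *)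
apply/negP => /mnm_lepP/(_ j); rewrite mnmBE mnm1E eqxx.
by rewrite leqNgt subn1 ltn_predL hj.
Qed.

Lemma homology_proj_eq0 q (z : cycles K q) :
  homology_proj K q z = 0 <-> exists c, boundary_cycles K q c = z.
Proof.
rewrite -[0](raddf0 (homology_proj K q)) (quot_pi_eq _ z 0) subr0.
exact: iff_refl.
Qed.

End Cells.

(** * From minimal presentations of cycles to presentations of homology *)

Lemma minimal_free_presentationP (F : fieldType) (n : nat) (V : gmod F n)
    (P : presentation V) : minimal_free_presentation P ->
  [/\ free_presentation P,
      forall x, pres_aug P x = 0 -> irrelevant_mul (pres_0 P) x &
      forall x, pres_map P x = 0 -> irrelevant_mul (pres_1 P) x].
Proof.
case=> Q [[frQ augQ ex0 exQ] minQ] ->; split=> /= [|x|x].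
  by split=> //; apply: frQ.
  by move/ex0 => [y <-]; apply: minQ.
by move/exQ => [y <-]; apply: minQ.
Qed.

Theorem proposition3p4 (F : fieldType) (n : nat) (n_ge1 : (1 <= n)%N)
    (X : cell_complex F) (K : filtration n X)
    (K_one_critical : one_critical K) (K_exhaustive : exhaustive K)
    (q : nat)
    (F1 F0 : gmod F n) (phi1 : ghom F1 F0) (eps : ghom F0 (cycles K q))
    (phi1_eps_minimal : minimal_free_presentation (Presentation phi1 eps))
    (dbar : ghom (chainmod K (q%:Z + 1)) F0)
    (eps_dbar : forall c, eps (dbar c) = boundary_cycles K q c) :
  [/\ free_presentation
        (Presentation (copair dbar phi1) (gcomp (homology_proj K q) eps)),
      forall u, supp_xi0 F0 u -> join_closure (entrance_grades K q) u &
      forall u, supp_xi0 (dsum (chainmod K (q%:Z + 1)) F1) u ->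
        entrance_grades K q.+1 u \/ join_closure (entrance_grades K q) u].
Proof.
have [[/= fr1 fr0 eps_surj phi_eps] min0 min1] :=
  minimal_free_presentationP phi1_eps_minimal.
have [h _ Kh] := K_one_critical.
have isoC k := chainmod_free k Kh.
have [r1 [a1 iso1]] := fr1; have [r0 [a0 iso0]] := fr0.
have iso_dsum := dsum_giso_free (isoC (q%:Z + 1)) iso1.
(* Followed by the inclusion into C_q, [eps] keeps its kernel and gets a free target, in which its
   image is the kernel of the boundary map. *)
pose incl : ghom (cycles K q) (chainmod K q) :=
  @Ghom _ _ (cycles K q) (chainmod K q) val (fun u v gv => gv).
have exC : exact_at (gcomp incl eps) (boundary K q).
  move=> v; split=> [zv|[x <-]]; last exact: submodP (eps x).
  have [x ex] := eps_surj (mk_submod (zv : kernel_submod (boundary K q) v)).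
  by exists x; rewrite /= ex.
have minC x : gcomp incl eps x = 0 -> irrelevant_mul F0 x.
  by move=> ex; apply: min0; apply: val_inj; rewrite [LHS]ex raddf0.
have tfC := @chainmod_torsion_free _ _ _ K.
have join0 j : join_closure (entrance_grades K q) (a0 j).
  apply: join_closure_join (minimal_generators_join iso0 (isoC q) (tfC _) exC minC j).
  move=> _ [[s ds] ->]; exists [:: h s]; split=> // [w|]; last by rewrite big_seq1.
  rewrite inE => /eqP->; exists s; last exact: entrance_gradeP.
  by move/eqP: ds => [].
have tfZ : torsion_free (cycles K q) by apply/sub_torsion_free/tfC.
have join1 i : join_closure (entrance_grades K q) (a1 i).
  apply: join_closure_join
    (minimal_generators_join iso1 iso0 tfZ phi_eps min1 i) => _ [j ->].
  exact: join0.
split=> [|u|u].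
- split=> //=; first exact: is_free_of_giso iso_dsum.
    move=> v; have [z <-] := quot_pi_surj v; have [x <-] := eps_surj z.
    by exists x.
  move=> v; rewrite (homology_proj_eq0 (eps v)); split=> [[c ec]|[[c x] <-]].
    (* If [eps v] bounds c, then v and [dbar c] differ by an element of ker [eps], which is the
       image of [phi1]. *)
    have /phi_eps [x ex] : eps (v - dbar c) = 0 by rewrite raddfB /= eps_dbar ec subrr.
    by exists (c, x); rewrite -[LHS]/(dbar c + phi1 x) ex addrC subrK.
  exists c; rewrite -[copair _ _ _]/(dbar c + phi1 x) raddfD /= eps_dbar.
  by have -> : eps (phi1 x) = 0 by [apply/phi_eps; exists x]; rewrite addr0.
- by case/(supp_xi0_free iso0) => j <-.
case/(supp_xi0_free iso_dsum) => -[[s ds]|i] <- /=; last by right.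
left; exists s; last exact: entrance_gradeP.
by move/eqP: ds; rewrite -PoszD addn1 => -[].
Qed.
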